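(* There is an $\omega$-model of $\mathrm{RCA}_0 + \mathrm{COH}$ that is not a model of $\mathrm{DNR}$. In particular, $\mathrm{COH}$ does not imply $\mathrm{DNR}$ over $\mathrm{RCA}_0$.
   Context: An $\omega$-model of $\mathrm{RCA}_0$ is identified with a Turing ideal (a nonempty subset of $2^\omega$ closed under Turing reducibility and join). An infinite set $X$ is cohesive for a family $R_0,R_1,\ldots$ of sets if for each $i$ one of $X\cap R_i$, $X\cap\overline{R_i}$ is finite. $\mathrm{COH}$ states that every family $\vec R=(R_i)_{i\in\mathbb N}$ (coded as a single set) has a cohesive set. $\mathrm{DNR}$ states that for every set $X$ there is a function $f$ with $f(e)\neq\Phi^X_e(e)$ for all $e$; an $\omega$-model satisfies it if for every $X$ in the model such an $f$ is in the model. *)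

(* Defs.v *)
From Stdlib Require Import Arith Bool Cantor.

Definition pair (x y : nat) : nat := Cantor.to_nat (x, y).
Definition fst' (n : nat) : nat := fst (Cantor.of_nat n).
Definition snd' (n : nat) : nat := snd (Cantor.of_nat n).

Definition set := nat -> bool.

Inductive code : Type :=
| CZero
| CSucc
| CFst
| CSnd
| COracle
| CPair (f g : code)
| CComp (f g : code)
| CPrimRec (f g : code)
| CMin (f : code).

Inductive eval (X : set) : code -> nat -> nat -> Prop :=
| ev_zero n : eval X CZero n 0
| ev_succ n : eval X CSucc n (S n)
| ev_fst n : eval X CFst n (fst' n)
| ev_snd n : eval X CSnd n (snd' n)
| ev_oracle n : eval X COracle n (if X n then 1 else 0)
| ev_pair f g n a b :
    eval X f n a -> eval X g n b -> eval X (CPair f g) n (pair a b)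
| ev_comp f g n a b :
    eval X g n a -> eval X f a b -> eval X (CComp f g) n b
| ev_prim0 f g x v :
    eval X f x v -> eval X (CPrimRec f g) (pair x 0) v
| ev_primS f g x k w v :
    eval X (CPrimRec f g) (pair x k) w ->
    eval X g (pair x (pair k w)) v ->
    eval X (CPrimRec f g) (pair x (S k)) v
| ev_min f x m :
    eval X f (pair x m) 0 ->
    (forall i, i < m -> exists w, w <> 0 /\ eval X f (pair x i) w) ->
    eval X (CMin f) x m.

(* Goedel numbering: decoding of natural numbers into codes (with fuel;
   fuel n+1 suffices since Cantor components of n are <= n).  Numbers
   that do not decode denote the nowhere-defined function. *)
Fixpoint decode_aux (fuel n : nat) : option code :=
  match fuel with
  | 0 => None
  | S k =>
    let t := fst' n in let r := snd' n in
    let two (C : code -> code -> code) :=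
      match decode_aux k (fst' r), decode_aux k (snd' r) with
      | Some a, Some b => Some (C a b) | _, _ => None end in
    match t with
    | 0 => Some CZero
    | 1 => Some CSucc
    | 2 => Some CFst
    | 3 => Some CSnd
    | 4 => Some COracle
    | 5 => two CPair
    | 6 => two CComp
    | 7 => two CPrimRec
    | 8 => match decode_aux k r with Some a => Some (CMin a) | None => None end
    | _ => None
    end
  end.

Definition decode (e : nat) : option code := decode_aux (S e) e.

Definition Phi (e : nat) (X : set) (n v : nat) : Prop :=
  match decode e with Some c => eval X c n v | None => False end.

Definition Treducible (Y X : set) : Prop :=
  exists c : code, forall n, eval X c n (if Y n then 1 else 0).

Definition join (X Y : set) : set :=
  fun n => if Nat.even n then X (Nat.div2 n) else Y (Nat.div2 n).

(* A Turing ideal = an omega-model of RCA_0. *)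
Definition TuringIdeal (M : set -> Prop) : Prop :=
  (exists X, M X) /\
  (forall X Y, M X -> Treducible Y X -> M Y) /\
  (forall X Y, M X -> M Y -> M (join X Y)).

Definition set_infinite (X : set) : Prop := forall m, exists n, m <= n /\ X n = true.
Definition set_finite (X : set) : Prop := exists m, forall n, m <= n -> X n = false.

Definition column (R : set) (i : nat) : set := fun n => R (pair i n).

Definition cohesive (X : set) (R : nat -> set) : Prop :=
  set_infinite X /\
  forall i, set_finite (fun n => X n && R i n) \/
            set_finite (fun n => X n && negb (R i n)).

Definition models_COH (M : set -> Prop) : Prop :=
  forall R, M R -> exists X, M X /\ cohesive X (column R).

(* A function f : nat -> nat belongs to an omega-model via its graph. *)
Definition graph (f : nat -> nat) : set :=
  fun k => Nat.eqb (snd' k) (f (fst' k)).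

Definition DNR_rel (f : nat -> nat) (X : set) : Prop :=
  forall e v, Phi e X e v -> f e <> v.

Definition models_DNR (M : set -> Prop) : Prop :=
  forall X, M X -> exists f, M (graph f) /\ DNR_rel f X.

(* Main.v *)
Require Import Defs.
From Stdlib Require Import Arith Bool Lia Cantor Classical IndefiniteDescription.

(** Starting from a set [X] computing no function that is DNR relative to the
    empty set, Mathias forcing with [X]-computable conditions produces an
    infinite set [C] that is cohesive for all [X]-computable sets at once and
    such that [X (+) C] still computes no such function: if some functional
    could neither be forced to be partial nor to agree somewhere with the
    diagonal function, then the values it takes on finite extensions of the
    condition, found by an [X]-computable search, would form a DNR function.
    Iterating this countably often and taking the generated Turing ideal gives
    the model. *)

(** * Pairing and the numbering of codes *)

Notation b2n b := (if b then 1 else 0).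

Lemma fst'_pair x y : fst' (pair x y) = x.
Proof. unfold fst', pair. now rewrite cancel_of_to. Qed.

Lemma snd'_pair x y : snd' (pair x y) = y.
Proof. unfold snd', pair. now rewrite cancel_of_to. Qed.

Lemma pair_fst'_snd' n : pair (fst' n) (snd' n) = n.
Proof.
  unfold fst', snd', pair. rewrite <- surjective_pairing. apply cancel_to_of.
Qed.

Lemma pair_inj x y x' y' : pair x y = pair x' y' -> x = x' /\ y = y'.
Proof.
  intros H. split.
  - now rewrite <- (fst'_pair x y), H, fst'_pair.
  - now rewrite <- (snd'_pair x y), H, snd'_pair.
Qed.

Lemma pair_ge_add x y : x + y <= pair x y.
Proof. unfold pair. rewrite Nat.add_comm. apply to_nat_non_decreasing. Qed.

Lemma decode_surjective c : exists e, decode e = Some c.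
Proof.
  (* Subcodes are decoded with whatever fuel the enclosing code leaves, so the induction must cover
     every fuel above [e]; components of a pair never exceed the pair. *)
  enough (H : exists e, forall k, e < k -> decode_aux k e = Some c).
  { destruct H as [e H]. exists e. apply H. lia. }
  induction c as [ | | | | |f [a Ha] g [b Hb]|f [a Ha] g [b Hb]|f [a Ha] g [b Hb]|f [a Ha]];
    [ exists (pair 0 0) | exists (pair 1 0) | exists (pair 2 0) | exists (pair 3 0)
    | exists (pair 4 0) | exists (pair 5 (pair a b)) | exists (pair 6 (pair a b))
    | exists (pair 7 (pair a b)) | exists (pair 8 a) ];
    intros [|k] Hk; try lia; cbn [decode_aux];
    rewrite !fst'_pair, ?snd'_pair, ?fst'_pair; try reflexivity.
  1-3: pose proof (pair_ge_add a b);
    match type of Hk with pair ?t ?r < _ => pose proof (pair_ge_add t r) end;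
    now rewrite Ha, Hb by lia.
  pose proof (pair_ge_add 8 a). now rewrite Ha by lia.
Qed.

(** * Functions computable from an oracle *)

Definition computable (X : set) (h : nat -> nat) : Prop :=
  exists c, forall n, eval X c n (h n).

Lemma computable_ext X h h' :
  (forall n, h n = h' n) -> computable X h -> computable X h'.
Proof. intros H [c Hc]. exists c. intros n. rewrite <- H. apply Hc. Qed.

Lemma computable_id X : computable X (fun n => n).
Proof.
  exists (CPair CFst CSnd). intros n. rewrite <- (pair_fst'_snd' n) at 2.
  constructor; constructor.
Qed.

Lemma computable_comp X h a :
  computable X h -> computable X a -> computable X (fun n => h (a n)).
Proof.
  intros [c Hc] [d Hd]. exists (CComp c d). intros n. econstructor; eauto.
Qed.

Lemma computable_pair X a b :
  computable X a -> computable X b -> computable X (fun n => pair (a n) (b n)).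
Proof. intros [c Hc] [d Hd]. exists (CPair c d). intros n. constructor; auto. Qed.

Lemma computable_fst X a : computable X a -> computable X (fun n => fst' (a n)).
Proof. apply computable_comp. exists CFst. constructor. Qed.

Lemma computable_snd X a : computable X a -> computable X (fun n => snd' (a n)).
Proof. apply computable_comp. exists CSnd. constructor. Qed.

Lemma computable_succ X a : computable X a -> computable X (fun n => S (a n)).
Proof. apply computable_comp. exists CSucc. constructor. Qed.

Lemma computable_const X k : computable X (fun _ => k).
Proof.
  induction k as [|k IH].
  - exists CZero. constructor.
  - now apply computable_succ.
Qed.

Lemma computable_oracle X : Treducible X X.
Proof. exists COracle. constructor. Qed.

(** The total counterpart of [CPrimRec] once the parameter is fixed. *)
Fixpoint natrec (a : nat) (g : nat -> nat -> nat) (k : nat) : nat :=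
  match k with 0 => a | S k => g k (natrec a g k) end.

Lemma computable_rec X f g a b :
  computable X f -> computable X (fun t => g (fst' t) (fst' (snd' t)) (snd' (snd' t))) ->
  computable X a -> computable X b ->
  computable X (fun n => natrec (f (a n)) (g (a n)) (b n)).
Proof.
  intros [c Hc] [d Hd] Ha Hb.
  assert (H : computable X (fun t =>
    natrec (f (fst' t)) (g (fst' t)) (snd' t))).
  { exists (CPrimRec c d). intros n. rewrite <- (pair_fst'_snd' n) at 1.
    induction (snd' n) as [|k IH]; cbn [natrec].
    - apply ev_prim0, Hc.
    - eapply ev_primS; [exact IH|].
      set (w := natrec _ _ k).
      specialize (Hd (pair (fst' n) (pair k w))).
      rewrite fst'_pair, !snd'_pair, fst'_pair in Hd. exact Hd. }
  eapply computable_ext; [|apply (computable_comp X _ _ H (computable_pair X _ _ Ha Hb))].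
  intros n. cbn beta. now rewrite fst'_pair, snd'_pair.
Qed.

(** A case distinction is a primitive recursion that ignores the previous value and reads only the
    predecessor. *)
Lemma computable_case X a b g :
  computable X a -> computable X b -> computable X (fun t => g (fst' t) (snd' t)) ->
  computable X (fun n => match a n with 0 => b n | S k => g n k end).
Proof.
  intros Ha Hb Hg.
  eapply computable_ext.
  2: apply (computable_rec X b (fun x k _ => g x k) (fun n => n) a Hb); auto.
  - intros n. cbn beta. now destruct (a n).
  - eapply computable_ext.
    2: apply (computable_comp X _ (fun t => pair (fst' t) (fst' (snd' t))) Hg).
    + intros n. cbn beta. now rewrite fst'_pair, snd'_pair.
    + apply computable_pair; [|apply computable_fst].
      1: apply computable_fst, computable_id.
      apply computable_snd, computable_id.
  - apply computable_id.
Qed.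

Lemma computable_if X (p : nat -> bool) a b :
  computable X (fun n => b2n (p n)) -> computable X a -> computable X b ->
  computable X (fun n => if p n then a n else b n).
Proof.
  intros Hp Ha Hb.
  eapply computable_ext.
  2: apply (computable_case X _ b (fun n _ => a n) Hp Hb).
  - intros n. cbn beta. now destruct (p n).
  - apply (computable_comp X a fst' Ha), computable_fst, computable_id.
Qed.

Lemma computable_comp2 X (h : nat -> nat -> nat) a b :
  computable X (fun t => h (fst' t) (snd' t)) -> computable X a -> computable X b ->
  computable X (fun n => h (a n) (b n)).
Proof.
  intros Hh Ha Hb. eapply computable_ext.
  2: apply (computable_comp X _ _ Hh (computable_pair X _ _ Ha Hb)).
  intros n. cbn beta. now rewrite fst'_pair, snd'_pair.
Qed.

Lemma computable_pred X a : computable X a -> computable X (fun n => pred (a n)).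
Proof.
  intros Ha. eapply computable_ext.
  2: apply (computable_case X a (fun _ => 0) (fun _ k => k) Ha (computable_const X 0)).
  - intros n. cbn beta. now destruct (a n).
  - apply computable_snd, computable_id.
Qed.

Ltac computability :=
  repeat first [ assumption | apply computable_id | apply computable_const
               | apply computable_pair | apply computable_succ | apply computable_pred
               | apply computable_fst | apply computable_snd ].

Lemma computable_min X (h m : nat -> nat) :
  computable X h ->
  (forall x, h (pair x (m x)) = 0) ->
  (forall x i, i < m x -> h (pair x i) <> 0) ->
  computable X m.
Proof.
  intros [c Hc] H0 H1. exists (CMin c). intros x. constructor.
  - rewrite <- (H0 x). apply Hc.
  - intros i Hi. exists (h (pair x i)). split; auto.
Qed.

Lemma computable_even X : Treducible Nat.even X.
Proof.
  enough (H : computable X (fun n => b2n (Nat.even n))) by exact H.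
  eapply computable_ext.
  2: apply (computable_rec X (fun _ => 1) (fun _ _ w => match w with 0 => 1 | S _ => 0 end)
              (fun n => n) (fun n => n)).
  - intros n. cbn beta. induction n as [|n IH]; [reflexivity|].
    rewrite Nat.even_succ, <- Nat.negb_even. cbn [natrec].
    rewrite IH. now destruct (Nat.even n).
  - apply computable_const.
  - apply (computable_case X _ (fun _ => 1) (fun _ _ => 0)); try apply computable_const.
    apply computable_snd, computable_snd, computable_id.
  - apply computable_id.
  - apply computable_id.
Qed.

(** Passing from [k] to [S k] raises the half exactly when [k] is odd. *)
Lemma computable_div2 X : computable X Nat.div2.
Proof.
  eapply computable_ext.
  2: apply (computable_rec X (fun _ => 0) (fun _ k w => if Nat.even k then w else S w)
              (fun n => n) (fun n => n)).
  - intros n. cbn beta. induction n as [|n IH]; [reflexivity|].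
    cbn [natrec] in *. rewrite IH.
    destruct (Nat.even n) eqn:E.
    + apply Nat.even_spec in E. destruct E as [m ->].
      now rewrite Nat.div2_succ_double, Nat.div2_double.
    + rewrite <- Nat.negb_odd in E. apply negb_false_iff, Nat.odd_spec in E.
      destruct E as [m ->]. replace (2 * m + 1) with (S (2 * m)) by lia.
      rewrite Nat.div2_succ_double. replace (S (S (2 * m))) with (2 * S m) by lia.
      now rewrite Nat.div2_double.
  - apply computable_const.
  - assert (Hw : computable X (fun t => snd' (snd' t)))
      by apply computable_snd, computable_snd, computable_id.
    apply computable_if; [|exact Hw|now apply computable_succ].
    apply (computable_comp X _ (fun t => fst' (snd' t)) (computable_even X)).
    apply computable_fst, computable_snd, computable_id.
  - apply computable_id.
  - apply computable_id.
Qed.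

Lemma computable_double X : computable X (fun n => 2 * n).
Proof.
  eapply computable_ext.
  2: apply (computable_rec X (fun _ => 0) (fun _ _ w => S (S w)) (fun n => n) (fun n => n)).
  - intros n. cbn beta. induction n as [|n IH]; [reflexivity|].
    cbn [natrec]. rewrite IH. lia.
  - apply computable_const.
  - apply computable_succ, computable_succ, computable_snd, computable_snd, computable_id.
  - apply computable_id.
  - apply computable_id.
Qed.

Lemma computable_andb X (p q : nat -> bool) :
  computable X (fun n => b2n (p n)) -> computable X (fun n => b2n (q n)) ->
  computable X (fun n => b2n (p n && q n)).
Proof.
  intros Hp Hq. eapply computable_ext.
  2: apply (computable_if X p (fun n => b2n (q n)) (fun _ => 0) Hp Hq), computable_const.
  intros n. cbn beta. now destruct (p n).
Qed.

Lemma computable_orb X (p q : nat -> bool) :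
  computable X (fun n => b2n (p n)) -> computable X (fun n => b2n (q n)) ->
  computable X (fun n => b2n (p n || q n)).
Proof.
  intros Hp Hq. eapply computable_ext.
  2: apply (computable_if X p (fun _ => 1) (fun n => b2n (q n)) Hp); [apply computable_const|exact Hq].
  intros n. cbn beta. now destruct (p n).
Qed.

Lemma computable_negb X (p : nat -> bool) :
  computable X (fun n => b2n (p n)) -> computable X (fun n => b2n (negb (p n))).
Proof.
  intros Hp. eapply computable_ext.
  2: apply (computable_if X p (fun _ => 0) (fun _ => 1) Hp); apply computable_const.
  intros n. cbn beta. now destruct (p n).
Qed.

Lemma computable_join X (p : set) (q : nat -> set) :
  Treducible p X -> computable X (fun t => b2n (q (fst' t) (snd' t))) ->
  computable X (fun t => b2n (join p (q (fst' t)) (snd' t))).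
Proof.
  intros Hp Hq.
  assert (Hs : computable X snd') by apply computable_snd, computable_id.
  assert (Hd : computable X (fun t => Nat.div2 (snd' t)))
    by apply (computable_comp X _ _ (computable_div2 X) Hs).
  eapply computable_ext.
  2: apply (computable_if X (fun t => Nat.even (snd' t))
              (fun t => b2n (p (Nat.div2 (snd' t))))
              (fun t => b2n (q (fst' t) (Nat.div2 (snd' t))))).
  - intros t. unfold join. now destruct (Nat.even (snd' t)).
  - apply (computable_comp X _ _ (computable_even X) Hs).
  - apply (computable_comp X _ _ Hp Hd).
  - eapply computable_ext.
    2: apply (computable_comp X _ (fun t => pair (fst' t) (Nat.div2 (snd' t))) Hq).
    + intros t. cbn beta. now rewrite fst'_pair, snd'_pair.
    + apply computable_pair; [apply computable_fst, computable_id|exact Hd].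
Qed.

(** The changed values are hard-coded one at a time: the value at 0 becomes a constant, and the
    shifted function has one value fewer to correct. *)
Lemma computable_finite_change X m : forall h h',
  computable X h -> (forall n, m <= n -> h' n = h n) -> computable X h'.
Proof.
  induction m as [|m IH]; intros h h' Hh E.
  - apply (computable_ext X h); [|exact Hh]. intros n. symmetry. apply E. lia.
  - assert (H : computable X (fun k => h' (S k))).
    { apply (IH (fun k => h (S k))).
      - apply (computable_comp X h S Hh), computable_succ, computable_id.
      - intros n Hn. apply E. lia. }
    eapply computable_ext.
    2: apply (computable_case X (fun n => n) (fun _ => h' 0) (fun _ k => h' (S k))).
    + intros [|n]; reflexivity.
    + apply computable_id.
    + apply computable_const.
    + apply (computable_comp X (fun k => h' (S k)) snd' H), computable_snd, computable_id.
Qed.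

Lemma computable_finite X (A : set) : set_finite A -> Treducible A X.
Proof.
  intros [m Hm]. apply (computable_finite_change X m (fun _ => 0) (fun n => b2n (A n))).
  - apply computable_const.
  - intros n Hn. now rewrite Hm.
Qed.

(** * A primitive recursive approximation of the evaluation relation *)

(* [0] means "no value found", [S v] means "value [v]".  Only the unbounded
   search needs the bound [s]: its state is [0] while searching, [1] after
   meeting an undefined value and [S (S m)] once [m] is found. *)
Fixpoint ev (X : set) (s : nat) (c : code) (n : nat) : nat :=
  match c with
  | CZero => 1
  | CSucc => S (S n)
  | CFst => S (fst' n)
  | CSnd => S (snd' n)
  | COracle => S (b2n (X n))
  | CPair f g =>
      match ev X s f n with
      | 0 => 0
      | S a => match ev X s g n with 0 => 0 | S b => S (pair a b) end
      end
  | CComp f g => match ev X s g n with 0 => 0 | S a => ev X s f a end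
  | CPrimRec f g =>
      natrec (ev X s f (fst' n))
        (fun k w => match w with
                    | 0 => 0
                    | S w => ev X s g (pair (fst' n) (pair k w))
                    end) (snd' n)
  | CMin f =>
      pred (natrec 0
        (fun i w => match w with
                    | 0 => match ev X s f (pair n i) with
                           | 0 => 1
                           | S v => match v with 0 => S (S i) | S _ => 0 end
                           end
                    | S w => S w
                    end) s)
  end.

Lemma ev_sound X s c : forall n v, ev X s c n = S v -> eval X c n v.
Proof.
  induction c as [ | | | | |f IHf g IHg|f IHf g IHg|f IHf g IHg|f IHf];
    intros n v H; cbn [ev] in H.
  1-5: injection H as <-; constructor.
  - destruct (ev X s f n) eqn:Ef; [discriminate|].
    destruct (ev X s g n) eqn:Eg; [discriminate|].
    injection H as <-. constructor; auto.
  - destruct (ev X s g n) eqn:Eg; [discriminate|]. econstructor; eauto.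
  - rewrite <- (pair_fst'_snd' n). revert v H.
    induction (snd' n) as [|k IH]; intros v H; cbn [natrec] in H.
    + apply ev_prim0. auto.
    + destruct (natrec _ _ k) eqn:E; [discriminate|].
      eapply ev_primS; eauto.
  - set (F := natrec _ _) in H.
    (* Invariant of the search after [t] steps: state 0 certifies nonzero values at all arguments
       tried, state [S (S m)] certifies [m] as the result, and the failure state 1 certifies
       nothing. *)
    assert (HF : forall t,
      (F t = 0 -> forall i, i < t -> exists w, w <> 0 /\ eval X f (pair n i) w) /\
      (forall m, F t = S (S m) -> eval X (CMin f) n m)).
    { induction t as [|t [IH0 IH1]]; [split; [lia|discriminate]|].
      assert (HS : F (S t) = match F t with
                    | 0 => match ev X s f (pair n t) with
                           | 0 => 1
                           | S v => match v with 0 => S (S t) | S _ => 0 end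
                           end
                    | S w => S w
                    end) by reflexivity.
      rewrite HS. clear HS. destruct (F t) as [|w].
      - specialize (IH0 eq_refl).
        destruct (ev X s f (pair n t)) as [|[|w]] eqn:E; split; try discriminate.
        + intros m [= <-]. constructor; auto.
        + intros _ i Hi. destruct (Nat.eq_dec i t) as [->|Hne].
          * exists (S w). split; [discriminate|auto].
          * apply IH0. lia.
      - split; [discriminate|]. exact IH1. }
    destruct (F s) as [|[|m]] eqn:E; try discriminate.
    injection H as <-. now apply (HF s).
Qed.

(** Plain inversion leaves an equation between pairs; injectivity of the pairing turns it into the
    two recursion clauses. *)
Lemma eval_prim_inv X f g x k v :
  eval X (CPrimRec f g) (pair x k) v ->
  match k with
  | 0 => eval X f x v
  | S k => exists w, eval X (CPrimRec f g) (pair x k) w /\ eval X g (pair x (pair k w)) v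
  end.
Proof.
  intros H. inversion H as [| | | | | | |? ? ? ? H1 H2 E|? ? ? ? ? ? H1 H2 H3 E|]; subst;
    apply pair_inj in E; destruct E as [-> <-]; eauto.
Qed.

(** Finitely many thresholds are dominated by one, here their sum. It supplies common step bounds
    and common uses. *)
Lemma bounded_max (P : nat -> nat -> Prop) m :
  (forall i, i < m -> exists s0, forall s, s0 <= s -> P i s) ->
  exists s0, forall s, s0 <= s -> forall i, i < m -> P i s.
Proof.
  induction m as [|m IH]; intros H.
  - exists 0. lia.
  - destruct IH as [a Ha]; [auto|]. destruct (H m) as [b Hb]; [lia|].
    exists (a + b). intros s Hs i Hi. destruct (Nat.eq_dec i m) as [->|].
    + apply Hb. lia.
    + apply Ha; lia.
Qed.

Lemma ev_complete X c : forall n v, eval X c n v ->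
  exists s0, forall s, s0 <= s -> ev X s c n = S v.
Proof.
  induction c as [ | | | | |f IHf g IHg|f IHf g IHg|f IHf g IHg|f IHf]; intros n v H.
  1-5: exists 0; intros s _; inversion H; reflexivity.
  - inversion H as [| | | | |? ? ? a b Ha Hb| | | |]; subst.
    apply IHf in Ha. apply IHg in Hb. destruct Ha as [s1 H1], Hb as [s2 H2].
    exists (s1 + s2). intros s Hs. cbn [ev]. now rewrite H1, H2 by lia.
  - inversion H as [| | | | | |? ? ? a b Ha Hb| | |]; subst.
    apply IHg in Ha. apply IHf in Hb. destruct Ha as [s1 H1], Hb as [s2 H2].
    exists (s1 + s2). intros s Hs. cbn [ev]. now rewrite H1, H2 by lia.
  - rewrite <- (pair_fst'_snd' n) in H. cbn [ev]. revert v H.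
    induction (snd' n) as [|k IH]; intros v H; apply eval_prim_inv in H.
    + cbn [natrec]. auto.
    + destruct H as (w & Hw & Hv). apply IH in Hw. apply IHg in Hv.
      destruct Hw as [s1 H1], Hv as [s2 H2].
      exists (s1 + s2). intros s Hs. cbn [natrec].
      rewrite H1 by lia. apply H2. lia.
  - inversion H as [| | | | | | | | |? ? ? Hm Hi]; subst.
    apply IHf in Hm. destruct Hm as [s1 H1].
    destruct (bounded_max (fun i s => exists w, ev X s f (pair n i) = S (S w)) v) as [s2 H2].
    { intros i Hlt. destruct (Hi i Hlt) as (w & Hw & Ew). apply IHf in Ew.
      destruct w as [|w]; [easy|]. destruct Ew as [s0 H0]. eauto. }
    (* [s1] settles the zero at [v], [s2] the nonzero values below it, and [S v] rounds are what the
       search takes to reach [v] and record it. *)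
    exists (s1 + s2 + S v). intros s Hs. cbn [ev].
    set (F := natrec _ _).
    assert (HS : forall t, F (S t) = match F t with
                    | 0 => match ev X s f (pair n t) with
                           | 0 => 1
                           | S v => match v with 0 => S (S t) | S _ => 0 end
                           end
                    | S w => S w
                    end) by reflexivity.
    assert (H0 : forall t, t <= v -> F t = 0).
    { induction t as [|t IH]; intros Ht; [reflexivity|].
      rewrite HS, IH by lia. destruct (H2 s ltac:(lia) t ltac:(lia)) as [w ->]. reflexivity. }
    (* Once recorded, the result survives all remaining rounds. *)
    assert (Hf : forall t, F (S v + t) = S (S v)).
    { induction t as [|t IH].
      - rewrite Nat.add_0_r, HS, H0, H1 by lia. reflexivity.
      - rewrite Nat.add_succ_r, HS, IH. reflexivity. }
    replace s with (S v + (s - S v)) by lia. now rewrite Hf.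
Qed.

Lemma eval_deterministic X c n v w : eval X c n v -> eval X c n w -> v = w.
Proof.
  intros Hv Hw. apply ev_complete in Hv, Hw. destruct Hv as [a Ha], Hw as [b Hb].
  specialize (Ha (a + b) ltac:(lia)). specialize (Hb (a + b) ltac:(lia)). congruence.
Qed.

(** Use principle: for fixed [s] the approximation is a total calculation with finitely many oracle
    queries. It therefore also covers the result 0, where no value is found. *)
Lemma ev_use X s c : forall n, exists u, forall Y,
  (forall q, q < u -> Y q = X q) -> ev Y s c n = ev X s c n.
Proof.
  induction c as [ | | | | |f IHf g IHg|f IHf g IHg|f IHf g IHg|f IHf]; intros n.
  1-4: now exists 0.
  - exists (S n). intros Y H. cbn [ev]. now rewrite H by lia.
  - destruct (IHf n) as [a Ha], (IHg n) as [b Hb]. exists (a + b). intros Y H. cbn [ev].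
    rewrite Ha, Hb by (intros; apply H; lia). reflexivity.
  (* [pred] recovers the inner value from its successor encoding; if the inner result is 0, the use
     taken for [f] only enlarges the bound harmlessly. *)
  - destruct (IHg n) as [b Hb], (IHf (pred (ev X s g n))) as [a Ha].
    exists (a + b). intros Y H. cbn [ev].
    rewrite Hb by (intros; apply H; lia). destruct (ev X s g n); [reflexivity|].
    apply Ha. intros; apply H; lia.
  - cbn [ev]. induction (snd' n) as [|k [a Ha]].
    + apply IHf.
    + set (w := natrec (ev X s f (fst' n)) _ k) in Ha.
      destruct (IHg (pair (fst' n) (pair k (pred w)))) as [b Hb].
      exists (a + b). intros Y H. cbn [natrec].
      rewrite Ha by (intros; apply H; lia).
      change (natrec (ev X s f (fst' n)) _ k) with w. destruct w; [reflexivity|].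
      apply Hb. intros; apply H; lia.
  - cbn [ev].
    destruct (bounded_max (fun i u => forall Y, (forall q, q < u -> Y q = X q) ->
                ev Y s f (pair n i) = ev X s f (pair n i)) s) as [u Hu].
    { intros i _. destruct (IHf (pair n i)) as [u Hu]. exists u. intros u' Hle Y H.
      apply Hu. intros; apply H; lia. }
    specialize (Hu u (le_n u)). exists u. intros Y H. f_equal.
    enough (E : forall t, t <= s ->
      natrec 0 (fun i w => match w with
        | 0 => match ev Y s f (pair n i) with
               | 0 => 1 | S v => match v with 0 => S (S i) | S _ => 0 end end
        | S w => S w end) t =
      natrec 0 (fun i w => match w with
        | 0 => match ev X s f (pair n i) with
               | 0 => 1 | S v => match v with 0 => S (S i) | S _ => 0 end end
        | S w => S w end) t) by now apply E.
    induction t as [|t IH]; intros Ht; [reflexivity|].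
    cbn [natrec]. rewrite IH by lia.
    rewrite (Hu t ltac:(lia) Y H). reflexivity.
Qed.

(** The oracle index and the step bound are inputs, so a single [X]-computable search can range over
    a whole family of oracles. The proof mirrors the clauses of [ev]. *)
Lemma ev_computable X (O : nat -> set) c :
  computable X (fun t => b2n (O (fst' t) (snd' t))) ->
  computable X (fun t => ev (O (fst' (fst' t))) (snd' (fst' t)) c (snd' t)).
Proof.
  intros HO.
  pose (T c (p n : nat) := ev (O (fst' p)) (snd' p) c n).
  change (computable X (fun t => T c (fst' t) (snd' t))).
  induction c as [ | | | | |f IHf g IHg|f IHf g IHg|f IHf g IHg|f IHf].
  1-4: unfold T; cbn [ev]; computability.
  - unfold T; cbn [ev]. apply computable_succ.
    apply (computable_comp2 X (fun d q => b2n (O d q)) (fun t => fst' (fst' t)) snd' HO);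
      computability.
  - apply (computable_case X (fun t => T f (fst' t) (snd' t)) (fun _ => 0)
      (fun t a => match T g (fst' t) (snd' t) with 0 => 0 | S b => S (pair a b) end));
      computability.
    apply (computable_case X (fun t => T g (fst' (fst' t)) (snd' (fst' t))) (fun _ => 0)
      (fun t b => S (pair (snd' t) b))); computability.
    apply (computable_comp2 X (T g)); computability.
  - apply (computable_case X (fun t => T g (fst' t) (snd' t)) (fun _ => 0)
      (fun t a => T f (fst' t) a)); computability.
    apply (computable_comp2 X (T f)); computability.
  - apply (computable_rec X (fun t => T f (fst' t) (fst' (snd' t)))
      (fun t k w => match w with
                    | 0 => 0
                    | S w => T g (fst' t) (pair (fst' (snd' t)) (pair k w))
                    end) (fun t => t) (fun t => snd' (snd' t))); computability.
    + apply (computable_comp2 X (T f)); computability.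
    + apply (computable_case X (fun t => snd' (snd' t)) (fun _ => 0)
        (fun t w => T g (fst' (fst' t))
                      (pair (fst' (snd' (fst' t))) (pair (fst' (snd' t)) w)))); computability.
      apply (computable_comp2 X (T g)); computability.
  - apply computable_pred.
    apply (computable_rec X (fun _ => 0)
      (fun t i w => match w with
                    | 0 => match T f (fst' t) (pair (snd' t) i) with
                           | 0 => 1
                           | S v => match v with 0 => S (S i) | S _ => 0 end
                           end
                    | S w => S w
                    end) (fun t => t) (fun t => snd' (fst' t))); computability.
    apply (computable_case X (fun t => snd' (snd' t))
      (fun t => match T f (fst' (fst' t)) (pair (snd' (fst' t)) (fst' (snd' t))) with
                | 0 => 1
                | S v => match v with 0 => S (S (fst' (snd' t))) | S _ => 0 end
                end) (fun _ w => S w)); computability.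
    apply (computable_case X
      (fun t => T f (fst' (fst' t)) (pair (snd' (fst' t)) (fst' (snd' t))))
      (fun _ => 1)
      (fun t v => match v with 0 => S (S (fst' (snd' t))) | S _ => 0 end)); computability.
    + apply (computable_comp2 X (T f)); computability.
    + apply (computable_case X snd' (fun t => S (S (fst' (snd' (fst' t))))) (fun _ _ => 0));
        computability.
Qed.

(** * Turing reducibility: transitivity and joins *)

Lemma computable_trans X Y h : computable Y h -> Treducible Y X -> computable X h.
Proof.
  intros [c Hc] [o Ho].
  (* The translation is proved for the partial relation, because subcodes of a code for a total
     function may be partial. *)
  enough (E : exists c', forall n v, eval Y c n v -> eval X c' n v).
  { destruct E as [c' E]. exists c'. auto. }
  clear h Hc.
  induction c as [ | | | | |f [f' Hf] g [g' Hg]|f [f' Hf] g [g' Hg]|f [f' Hf] g [g' Hg]|f [f' Hf]].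
  - exists CZero. intros n v H. inversion H. constructor.
  - exists CSucc. intros n v H. inversion H. constructor.
  - exists CFst. intros n v H. inversion H. constructor.
  - exists CSnd. intros n v H. inversion H. constructor.
  - exists o. intros n v H. inversion H. apply Ho.
  - exists (CPair f' g'). intros n v H. inversion H; subst. constructor; auto.
  - exists (CComp f' g'). intros n v H. inversion H; subst. econstructor; eauto.
  - exists (CPrimRec f' g'). intros n v H. rewrite <- (pair_fst'_snd' n) in *.
    revert v H. induction (snd' n) as [|k IH]; intros v H; apply eval_prim_inv in H.
    + apply ev_prim0. auto.
    + destruct H as (w & Hw & Hv). eapply ev_primS; eauto.
  - exists (CMin f'). intros n v H. inversion H as [| | | | | | | | |? ? ? Hm Hi]; subst.
    constructor; auto. intros i Hlt. destruct (Hi i Hlt) as (w & Hw & Ew). eauto.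
Qed.

Lemma Treducible_join_l X Y : Treducible X (join X Y).
Proof.
  eapply computable_ext.
  2: apply (computable_comp (join X Y) _ (fun n => 2 * n)
              (computable_oracle _) (computable_double _)).
  intros n. unfold join. now rewrite Nat.even_even, Nat.div2_double.
Qed.

Lemma Treducible_join_r X Y : Treducible Y (join X Y).
Proof.
  eapply computable_ext.
  2: apply (computable_comp (join X Y) _ (fun n => S (2 * n))
              (computable_oracle _) (computable_succ _ _ (computable_double _))).
  intros n. unfold join.
  now rewrite Nat.even_succ, <- Nat.negb_even, Nat.even_even, Nat.div2_succ_double.
Qed.

Lemma Treducible_join X Y Z : Treducible X Z -> Treducible Y Z -> Treducible (join X Y) Z.
Proof.
  intros HX HY.
  assert (H : computable Z (fun t => b2n (join X Y (snd' t)))).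
  { apply (computable_join Z X (fun _ => Y) HX).
    apply (computable_comp Z _ snd' HY). computability. }
  eapply computable_ext.
  2: apply (computable_comp Z _ (fun n => pair 0 n) H); computability.
  intros n. cbn beta. now rewrite snd'_pair.
Qed.

Lemma computable_of_graph X f : Treducible (graph f) X -> computable X f.
Proof.
  intros H. apply (computable_min X (fun t => if graph f t then 0 else 1)).
  - apply computable_if; computability.
  - intros x. unfold graph. now rewrite snd'_pair, fst'_pair, Nat.eqb_refl.
  - intros x i Hi. unfold graph. rewrite snd'_pair, fst'_pair.
    destruct (Nat.eqb_spec i (f x)); lia.
Qed.

(** * Mathias forcing *)

Definition empty : set := fun _ => false.

(** Diagonalising against the empty oracle is enough to refute [models_DNR], and the fixed oracle
    lets the property be carried unchanged through the iteration. *)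
Definition computes_no_DNR (X : set) : Prop :=
  forall f, computable X f -> ~ DNR_rel f empty.

(** A computable [f] has an index [e], and at its own index it equals the diagonal. *)
Lemma empty_computes_no_DNR : computes_no_DNR empty.
Proof.
  intros f [c Hc] Hf. destruct (decode_surjective c) as [e He].
  apply (Hf e (f e)); [|reflexivity]. unfold Phi. rewrite He. apply Hc.
Qed.

(* Finite sets coded by numbers: a number is read as an infinite sequence of
   numbers by repeatedly splitting it with the pairing function. *)
Definition bits (d : nat) : set :=
  fun q => match fst' (natrec d (fun _ w => snd' w) q) with 0 => false | S _ => true end.

Lemma bits_surjective u : forall P : set, exists d, forall q, q < u -> bits d q = P q.
Proof.
  induction u as [|u IH]; intros P; [exists 0; lia|].
  destruct (IH (fun q => P (S q))) as [d Hd]. exists (pair (b2n (P 0)) d).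
  assert (E : forall q, natrec (pair (b2n (P 0)) d) (fun _ w => snd' w) (S q) =
                        natrec d (fun _ w => snd' w) q).
  { induction q as [|q IHq]; cbn [natrec] in *; [apply snd'_pair|now rewrite IHq]. }
  intros [|q] Hq; unfold bits.
  - cbn [natrec]. rewrite fst'_pair. now destruct (P 0).
  - rewrite E. apply Hd. lia.
Qed.

Lemma bits_computable X : computable X (fun t => b2n (bits (fst' t) (snd' t))).
Proof.
  eapply computable_ext.
  2: apply (computable_case X (fun t => fst' (natrec (fst' t) (fun _ w => snd' w) (snd' t)))
              (fun _ => 0) (fun _ _ => 1)); computability.
  - intros t. cbn beta. unfold bits. now destruct (fst' (natrec _ _ _)).
  - apply (computable_rec X (fun d => d) (fun _ _ w => snd' w) fst' snd'); computability.
Qed.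

Definition subset (A B : set) : Prop := forall n, A n = true -> B n = true.

(* The condition [(A, B)] stands for all sets between [A] and [B]. *)
Definition condition (X A B : set) : Prop :=
  set_finite A /\ subset A B /\ set_infinite B /\ Treducible B X.

Lemma condition_infinite X A B e : condition X A B ->
  exists A', condition X A' B /\ subset A A' /\ exists n, e <= n /\ A' n = true.
Proof.
  intros (HA & HAB & HB & HBX). destruct (HB e) as (n & Hn & Bn).
  exists (fun q => A q || (q =? n)). repeat split; auto.
  - destruct HA as [m Hm]. exists (m + S n). intros q Hq. rewrite Hm by lia.
    destruct (Nat.eqb_spec q n); [lia|reflexivity].
  - intros q Hq. apply orb_true_iff in Hq. destruct Hq as [Hq|Hq]; auto.
    apply Nat.eqb_eq in Hq. now subst.
  - intros q Hq. now rewrite Hq.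
  - exists n. split; [exact Hn|]. rewrite Nat.eqb_refl. apply orb_true_r.
Qed.

Lemma condition_restrict X A B P : condition X A B -> Treducible P X ->
  set_infinite (fun n => B n && P n) ->
  exists B', condition X A B' /\ subset B' B /\ set_finite (fun n => B' n && negb (P n)).
Proof.
  (* [A] is kept so that it stays below the new upper set; being finite, it harms neither
     computability nor almost inclusion in [P]. *)
  intros (HA & HAB & HB & HBX) HS Hinf. exists (fun n => A n || (B n && P n)).
  repeat split; auto.
  - intros n Hn. now rewrite Hn.
  - intros m. destruct (Hinf m) as (n & Hm & Hn). exists n. split; [exact Hm|].
    rewrite Hn. apply orb_true_r.
  - apply (computable_orb X A (fun n => B n && P n)).
    + now apply computable_finite.
    + now apply computable_andb.
  - intros n Hn. apply orb_true_iff in Hn. destruct Hn as [Hn|Hn]; auto.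
    now apply andb_true_iff in Hn.
  - destruct HA as [m Hm]. exists m. intros n Hn. rewrite Hm by exact Hn.
    now destruct (B n), (P n).
Qed.

Lemma infinite_split B P : set_infinite B ->
  set_infinite (fun n => B n && P n) \/ set_infinite (fun n => B n && negb (P n)).
Proof.
  intros HB. destruct (classic (set_infinite (fun n => B n && P n))) as [H|H]; [auto|right].
  apply not_all_ex_not in H. destruct H as [m Hm]. intros k.
  destruct (HB (k + m)) as (n & Hn & Bn). exists n. split; [lia|]. rewrite Bn.
  destruct (P n) eqn:E; [|reflexivity]. exfalso. apply Hm. exists n. split; [lia|].
  now rewrite Bn, E.
Qed.

Lemma condition_cohesive X A B P : condition X A B -> Treducible P X ->
  exists B', condition X A B' /\ subset B' B /\
    (set_finite (fun n => B' n && P n) \/ set_finite (fun n => B' n && negb (P n))).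
Proof.
  intros HC HS. destruct (infinite_split B P) as [H|H]; [apply HC| |].
  - destruct (condition_restrict X A B P HC HS H) as (B' & ? & ? & ?). exists B'. auto.
  - destruct (condition_restrict X A B (fun n => negb (P n)) HC) as (B' & ? & ? & [m Hm]).
    + now apply computable_negb.
    + exact H.
    + exists B'. split; [assumption|]. split; [assumption|]. left. exists m. intros n Hn.
      rewrite <- (Hm n Hn). now rewrite negb_involutive.
Qed.

(** A query [q] to the join reaches its right half at [Nat.div2 q], which is at most [q]. *)
Lemma join_agree X C D u : (forall q, q < u -> C q = D q) ->
  forall q, q < u -> join X C q = join X D q.
Proof.
  intros H q Hq. unfold join. destruct (Nat.even q); [reflexivity|].
  apply H. pose proof (Nat.div2_decr q q). destruct q; cbn in *; lia.
Qed.

Lemma condition_DNR X A B c : computes_no_DNR X -> condition X A B ->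
  exists A' B', condition X A' B' /\ subset A A' /\ subset B' B /\
    forall C, subset A' C -> subset C B' ->
    forall f, (forall n, eval (join X C) c n (f n)) -> ~ DNR_rel f empty.
Proof.
  intros HX HC. pose proof HC as (HA & HAB & HB & HBX).
  (* [O d] lies between [A] and [B] for every [d], and these sets match any [C] between [A] and [B]
     on any given initial segment. *)
  pose (O d := (fun q => A q || (bits d q && B q)) : set).
  assert (HO : computable X (fun t => b2n (O (fst' t) (snd' t)))).
  { apply (computable_orb X (fun t => A (snd' t))
             (fun t => bits (fst' t) (snd' t) && B (snd' t))).
    - apply (computable_comp X (fun n => b2n (A n)) snd'); [|computability].
      now apply computable_finite.
    - apply (computable_andb X (fun t => bits (fst' t) (snd' t))); [apply bits_computable|].
      apply (computable_comp X (fun n => b2n (B n)) snd'); [exact HBX|computability]. }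
  (* The search variable [w] packs the code of an extension with a step bound. *)
  pose (T w n := ev (join X (O (fst' w))) (snd' w) c n).
  assert (HT : computable X (fun t => T (fst' t) (snd' t))).
  { apply (ev_computable X (fun d => join X (O d))). apply computable_join; [|exact HO].
    apply computable_oracle. }
  (* Some finite extension makes the functional agree with the diagonal: freeze its use. *)
  destruct (classic (exists n w v, T w n = S v /\ Phi n empty n v)) as [H1|H1].
  { destruct H1 as (n & w & v & Hv & Hphi). unfold T in Hv.
    destruct (ev_use (join X (O (fst' w))) (snd' w) c n) as [u Hu].
    set (D := O (fst' w)) in *.
    (* Below [u] both bounds equal [D], so every set between them answers the computation as [D]
       does; from [u] on the old condition is kept. *)
    pose (A' := (fun q => if q <? u then D q else A q) : set).
    pose (B' := (fun q => if q <? u then D q else B q) : set).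
    assert (HDA : subset A D) by (intros q Hq; unfold D, O; now rewrite Hq).
    assert (HDB : subset D B).
    { intros q Hq. unfold D, O in Hq. apply orb_true_iff in Hq. destruct Hq as [Hq|Hq]; auto.
      now apply andb_true_iff in Hq. }
    exists A', B'. repeat split.
    - destruct HA as [m Hm]. exists (m + u). intros q Hq. unfold A'.
      destruct (Nat.ltb_spec q u); [lia|]. apply Hm. lia.
    - intros q. unfold A', B'. destruct (q <? u); auto.
    - intros m. destruct (HB (m + u)) as (q & Hq & Bq). exists q. split; [lia|].
      unfold B'. destruct (Nat.ltb_spec q u); [lia|exact Bq].
    - apply (computable_finite_change X u (fun q => b2n (B q)) _ HBX). intros q Hq.
      unfold B'. destruct (Nat.ltb_spec q u); [lia|reflexivity].
    - intros q. unfold A'. destruct (q <? u); auto.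
    - intros q. unfold B'. destruct (q <? u); auto.
    - intros C HAC HCB f Hf Hdnr. apply (Hdnr n v Hphi).
      apply (eval_deterministic (join X C) c n); [apply Hf|].
      apply (ev_sound _ (snd' w)). rewrite Hu; [exact Hv|].
      apply join_agree. intros q Hq. specialize (HAC q). specialize (HCB q).
      unfold A', B' in *. destruct (Nat.ltb_spec q u); [|lia].
      destruct (C q), (D q); auto. symmetry; auto. }
  (* No extension makes the functional converge at [n]: divergence is already forced. *)
  destruct (classic (exists n, forall w, T w n = 0)) as [[n H2]|H2].
  { exists A, B. repeat split; auto; try (intros q Hq; exact Hq).
    intros C HAC HCB f Hf _. specialize (Hf n). apply ev_complete in Hf.
    destruct Hf as [s Hs]. specialize (Hs s (le_n s)).
    destruct (ev_use (join X C) s c n) as [u Hu].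
    (* A convergent computation from [C] would already be found with the code [d] of [C] below its
       use and the bound [s]. *)
    destruct (bits_surjective u C) as [d Hd].
    specialize (H2 (pair d s)). unfold T in H2. rewrite fst'_pair, snd'_pair in H2.
    rewrite Hu in H2; [congruence|]. apply join_agree. intros q Hq. unfold O.
    rewrite Hd by exact Hq. specialize (HAC q). specialize (HCB q).
    destruct (A q), (C q), (B q); auto; symmetry; auto. }
  (* Otherwise the first value found by searching extensions is a DNR function. *)
  exfalso.
  assert (H3 : forall n, exists w, T w n <> 0 /\ forall i, i < w -> T i n = 0).
  { intros n.
    destruct (dec_inh_nat_subset_has_unique_least_element (fun w => T w n <> 0))
      as (w & (Hw & Hmin) & _).
    - intros w. destruct (T w n); [right; lia|left; lia].
    - apply NNPP. intros H. apply H2. exists n. intros w. apply NNPP. intros Hw. eauto.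
    - exists w. split; [exact Hw|]. intros i Hi. destruct (Nat.eq_dec (T i n) 0) as [E|E]; auto.
      specialize (Hmin i E). lia. }
  apply functional_choice in H3. destruct H3 as [m Hm].
  (* Although [m] comes from choice, its leastness makes it the outcome of an [X]-computable
     minimisation. *)
  assert (Hcm : computable X m).
  { apply (computable_min X (fun t => match T (snd' t) (fst' t) with 0 => 1 | S _ => 0 end)).
    - apply (computable_case X (fun t => T (snd' t) (fst' t)) (fun _ => 1) (fun _ _ => 0));
        computability.
      apply (computable_comp2 X T snd' fst'); computability.
    - intros n. rewrite fst'_pair, snd'_pair. destruct (Hm n) as [H _].
      destruct (T (m n) n); lia.
    - intros n i Hi. rewrite fst'_pair, snd'_pair. destruct (Hm n) as [_ H].
      rewrite H by exact Hi. discriminate. }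
  apply (HX (fun n => pred (T (m n) n))).
  - apply computable_pred.
    apply (computable_comp2 X T m (fun n => n)); computability.
  (* Agreement with the diagonal at [n] would be an instance of the first case, witnessed by
     [m n]. *)
  - intros n v Hphi E. apply H1. exists n, (m n), v. split; [|exact Hphi].
    destruct (Hm n) as [H _]. lia.
Qed.

(** * The sequence of conditions and its generic set *)

Definition forces_requirements (X : set) (e : nat) (A B : set) : Prop :=
  (exists n, e <= n /\ A n = true) /\
  forall c, decode e = Some c ->
    (forall P : set, (forall n, eval X c n (b2n (P n))) ->
       set_finite (fun n => B n && P n) \/ set_finite (fun n => B n && negb (P n))) /\
    (forall C, subset A C -> subset C B ->
       forall f, (forall n, eval (join X C) c n (f n)) -> ~ DNR_rel f empty).

(** One index [e] does triple duty: lower bound for an element of the set, code of a set to be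
    decided, and code of a functional to be defeated. Thus one step per index meets all
    requirements, each refinement preserving what was forced before. *)
Lemma condition_step X e A B : computes_no_DNR X -> condition X A B ->
  exists A' B', condition X A' B' /\ subset A A' /\ subset B' B /\
    forces_requirements X e A' B'.
Proof.
  intros HX HC.
  destruct (condition_infinite X A B e HC) as (A1 & HC1 & HA1 & n & Hn & A1n).
  unfold forces_requirements. destruct (decode e) as [c|].
  2: { exists A1, B. repeat split; auto; try apply HC1; try discriminate.
       - intros q Hq; exact Hq.
       - eauto. }
  destruct (condition_DNR X A1 B c HX HC1) as (A2 & B2 & HC2 & HA2 & HB2 & HD).
  assert (H3 : exists B3, condition X A2 B3 /\ subset B3 B2 /\
    forall P : set, (forall n, eval X c n (b2n (P n))) ->
      set_finite (fun n => B3 n && P n) \/ set_finite (fun n => B3 n && negb (P n))).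
  (* If [c] computes a set at all, determinism makes that set unique, so deciding one [P] is
     enough. *)
  { destruct (classic (exists P : set, forall n, eval X c n (b2n (P n)))) as [[P HP]|HP].
    - destruct (condition_cohesive X A2 B2 P HC2) as (B3 & HC3 & HB3 & H3).
      { now exists c. }
      exists B3. repeat split; auto; try apply HC3. intros P' HP'.
      assert (E : forall q, P' q = P q).
      { intros q. pose proof (eval_deterministic _ _ _ _ _ (HP q) (HP' q)).
        now destruct (P q), (P' q). }
      destruct H3 as [[k Hk]|[k Hk]]; [left|right]; exists k; intros q Hq;
        rewrite E; auto.
    - exists B2. repeat split; auto; try apply HC2; [intros q Hq; exact Hq|].
      intros P HP'. exfalso. eauto. }
  destruct H3 as (B3 & HC3 & HB3 & H3).
  exists A2, B3. split; [exact HC3|]. split; [intros q Hq; auto|].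
  split; [intros q Hq; auto|]. split; [exists n; auto|].
  intros c' [= <-]. split; [exact H3|]. intros C HAC HCB.
  apply HD; [exact HAC|]. intros q Hq. auto.
Qed.

(** The relation may depend on the stage, which lets stage [e] attend to index [e]. *)
Lemma dependent_choice {T : Type} (R : nat -> T -> T -> Prop) (x0 : T) :
  (forall n x, exists y, R n x y) ->
  exists s : nat -> T, s 0 = x0 /\ forall n, R n (s n) (s (S n)).
Proof.
  intros H.
  pose (step n x := proj1_sig (constructive_indefinite_description _ (H n x))).
  exists (fix s n := match n with 0 => x0 | S n => step n (s n) end).
  split; [reflexivity|]. intros n.
  exact (proj2_sig (constructive_indefinite_description _ (H n _))).
Qed.

Lemma cohesive_no_DNR X : computes_no_DNR X ->
  exists C, computes_no_DNR (join X C) /\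
    forall R, Treducible R X -> cohesive C (column R).
Proof.
  intros HX.
  (* Bundling the condition with its proof lets the choice principle iterate on conditions
     directly. *)
  pose (cond := {p : set * set | condition X (fst p) (snd p)}).
  assert (p0 : cond).
  { exists (empty, fun _ => true). split; [|split; [|split]]; cbn.
    - exists 0. reflexivity.
    - intros n Hn. discriminate.
    - intros m. exists m. auto.
    - exact (computable_const X 1). }
  destruct (dependent_choice (fun e (p q : cond) =>
    let A := fst (proj1_sig p) in let B := snd (proj1_sig p) in
    let A' := fst (proj1_sig q) in let B' := snd (proj1_sig q) in
    subset A A' /\ subset B' B /\
    forces_requirements X e A' B') p0)
    as (s & _ & Hs).
  { intros e [[A B] HC]. destruct (condition_step X e A B HX HC) as (A' & B' & HC' & H).
    exists (exist _ (A', B') HC'). exact H. }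
  pose (A n := fst (proj1_sig (s n))). pose (B n := snd (proj1_sig (s n))).
  assert (HA : forall k n, subset (A n) (A (k + n))).
  { induction k as [|k IH]; intros n q Hq; [exact Hq|].
    apply (Hs (k + n)). now apply IH. }
  assert (HB : forall k n, subset (B (k + n)) (B n)).
  { induction k as [|k IH]; intros n q Hq; [exact Hq|].
    apply IH. now apply (Hs (k + n)). }
  (* Both sets are compared at the common stage [m + n]. *)
  assert (HAB : forall m n, subset (A m) (B n)).
  { intros m n q Hq. apply (HB m n).
    destruct (proj2_sig (s (m + n))) as (_ & H & _). apply H.
    rewrite Nat.add_comm. now apply HA. }
  (* [C] is the union of all [A m], hence lies between every [A n] and every [B n]. *)
  destruct (functional_choice (fun q b => b = true <-> exists m, A m q = true)) as [C HC].
  { intros q. destruct (classic (exists m, A m q = true)) as [H|H].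
    - now exists true.
    - exists false. now split. }
  assert (HAC : forall n, subset (A n) C) by (intros n q Hq; apply HC; eauto).
  assert (HCB : forall n, subset C (B n)).
  { intros n q Hq. apply HC in Hq. destruct Hq as [m Hq]. eapply HAB; eauto. }
  exists C. split.
  - intros f [c Hc]. destruct (decode_surjective c) as [e He].
    destruct (Hs e) as (_ & _ & _ & H). destruct (H c He) as [_ HD].
    exact (HD C (HAC (S e)) (HCB (S e)) f Hc).
  - intros R HR. split.
    + intros e. destruct (Hs e) as (_ & _ & (n & Hn & An) & _).
      exists n. split; [exact Hn|]. exact (HAC (S e) n An).
    + intros i.
      assert (HRi : Treducible (column R i) X).
      { apply (computable_comp X _ (fun n => pair i n) HR). computability. }
      destruct HRi as [c Hc]. destruct (decode_surjective c) as [e He].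
      destruct (Hs e) as (_ & _ & _ & H). destruct (H c He) as [HD _].
      (* The decision made for [B (S e)] passes down to its subset [C]. *)
      assert (Hle : forall P : set, set_finite (fun n => B (S e) n && P n) ->
                set_finite (fun n => C n && P n)).
      { intros P [m Hm]. exists m. intros n Hn. specialize (Hm n Hn).
        specialize (HCB (S e) n). destruct (C n); [|reflexivity].
        now rewrite HCB in Hm. }
      destruct (HD _ Hc) as [H'|H']; [left|right]; now apply Hle.
Qed.

(** * Iteration and the resulting Turing ideal *)

Theorem theorem3p7 :
  exists M : set -> Prop, TuringIdeal M /\ models_COH M /\ ~ models_DNR M.
Proof.
  (* Each stage joins to the current set one [C] that is cohesive for all families computable from
     it. *)
  destruct (dependent_choice (fun _ (X Y : {X | computes_no_DNR X}) =>
    exists C, proj1_sig Y = join (proj1_sig X) C /\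
      forall R, Treducible R (proj1_sig X) -> cohesive C (column R))
    (exist _ empty empty_computes_no_DNR)) as (s & H0 & Hs).
  { intros _ [X HX]. destruct (cohesive_no_DNR X HX) as (C & HC & Hcoh).
    exists (exist _ (join X C) HC). now exists C. }
  pose (X n := proj1_sig (s n)).
  assert (Hup : forall k n, Treducible (X n) (X (k + n))).
  { induction k as [|k IH]; intros n; [apply computable_oracle|].
    apply (computable_trans _ (X (k + n)) _ (IH n)).
    destruct (Hs (k + n)) as (C & E & _). unfold X. cbn [Nat.add]. rewrite E.
    apply Treducible_join_l. }
  exists (fun Y => exists n, Treducible Y (X n)). split; [|split].
  - split; [|split].
    + exists (X 0), 0. apply computable_oracle.
    + intros Y Z [n Hn] HZ. exists n. exact (computable_trans _ _ _ HZ Hn).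
    + intros Y Z [n Hn] [m Hm]. exists (m + n). apply Treducible_join.
      * exact (computable_trans _ _ _ Hn (Hup m n)).
      * rewrite Nat.add_comm. exact (computable_trans _ _ _ Hm (Hup n m)).
  (* A family that appears by stage [n] receives its cohesive set at stage [S n]. *)
  - intros R [n Hn]. destruct (Hs n) as (C & E & HC). exists C. split.
    + exists (S n). unfold X. rewrite E. apply Treducible_join_r.
    + now apply HC.
  (* A DNR function in the ideal would be computable from a single stage, contradicting the property
     preserved there. *)
  - intros HD. destruct (HD empty) as (f & [n Hn] & Hf).
    + exists 0. unfold X. rewrite H0. apply computable_oracle.
    + exact (proj2_sig (s n) f (computable_of_graph _ _ Hn) Hf).
Qed.
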